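(* Let $\mu$ be a Markov measure on $X^{\mathbb N}$ defined by an irreducible stochastic matrix $L$ with stationary probability vector $\boldsymbol{l}$ and let $g:X^{\mathbb N}\to X^{\mathbb N}$ be an invertible transformation generated by an $L$-strongly connected automaton $\mathcal A=(X,S,\pi,\lambda)$. Suppose that $\boldsymbol{t}=\boldsymbol{k}\otimes\boldsymbol{l}$, where $\boldsymbol{t}$ is the stationary probability vector of the matrix $T_{L,\mathcal A}$ and $\boldsymbol{k}$ is the stationary probability vector of the matrix $K_{\boldsymbol{l},\mathcal A}$. Then the measures $\mu$ and $g_*\mu$ are either singular or the same.
   Context: $X$ is a finite set (alphabet) with more than one element, $X^*$ the set of finite words over $X$ (including the empty word), $X^{\mathbb N}$ the set of infinite sequences over $X$ with the product topology; $wX^{\mathbb N}$ is the set of sequences with prefix $w$. The Markov measure defined by a stochastic matrix $L=(L_{xy})_{x,y\in X}$ with stationary probability vector $\boldsymbol{l}$ ($\boldsymbol{l}L=\boldsymbol{l}$) is the Borel probability measure with $\mu(x_1\ldots x_nX^{\mathbb N})=\boldsymbol{l}_{x_1}L_{x_1x_2}\cdots L_{x_{n-1}x_n}$. Pushforward: $g_*\mu(E)=\mu(g^{-1}(E))$. Two measures are singular if they are concentrated on disjoint Borel sets. An automaton $\mathcal A=(X,S,\pi,\lambda)$ consists of the alphabet $X$, a nonempty finite set $S$ of states, a transition function $\pi:S\times X\to S$ and an output function $\lambda:S\times X\to X$. The transition function is extended to words by $\pi(s,\varnothing)=s$, $\pi(s,xw)=\pi(\pi(s,x),w)$. Each state $s$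 acts on $X^{\mathbb N}$ by $\omega_1\omega_2\ldots\mapsto\lambda(s_0,\omega_1)\lambda(s_1,\omega_2)\ldots$, where $s_0=s$ and $s_n=\pi(s_{n-1},\omega_n)$. A transformation is generated by $\mathcal A$ if it is the action of some (initial) state of $\mathcal A$. $\mathcal A$ is $L$-strongly connected if for any states $s,r\in S$ and any symbols $x,y\in X$ there is a word $w=w_1\ldots w_n\in X^*$ (possibly empty) such that $\pi(s,xw)=r$ and all transitions between consecutive letters of the word $xwy$ have nonzero probability, i.e. $L_{xw_1},L_{w_1w_2},\dots,L_{w_{n-1}w_n},L_{w_ny}$ are all nonzero ($L_{xy}\ne0$ if $w$ is empty). The stochastic matrix $T_{L,\mathcal A}$ has rows and columns indexed by $S\times X$, with $T_{(s_0,x_0)(s_1,x_1)}=L_{x_0x_1}$ if $\pi(s_0,x_0)=s_1$ and $0$ otherwise. The stochastic matrix $K_{\boldsymbol{l},\mathcal A}$ has rows and columns indexed by $S$, with $K_{s_0s_1}=\sum_{x\in X:\,\pi(s_0,x)=s_1}\boldsymbol{l}_x$. (Under the hypotheses both are irreducible, so $\boldsymbol{t}$ and $\boldsymbol{k}$ are unique.) The vector $\boldsymbol{k}\otimes\boldsymbol{l}$ is indexed by $S\times X$ and given by $(\boldsymbol{k}\otimes\boldsymbol{l})_{(s,x)}=\boldsymbol{k}_s\boldsymbol{l}_x$. *)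

(* Defs.v *)
From HB Require Import structures.
From mathcomp Require Import all_boot all_order all_algebra.
From mathcomp Require Import all_classical all_reals all_analysis.

Set Implicit Arguments.
Unset Strict Implicit.
Unset Printing Implicit Defensive.

Import Order.TTheory GRing.Theory Num.Theory.

Local Open Scope classical_set_scope.
Local Open Scope ring_scope.

(* The cardinality condition is bundled with the alphabet because it makes the
   space of sequences pointed, which measurableType requires. *)
Record alphabet := Alphabet {
  symbol :> finType;
  card_symbol_gt1 : (1 < #|symbol|)%N }.

Definition symbol_point (X : alphabet) : X :=
  enum_val (Ordinal (ltnW (card_symbol_gt1 X))).

(* X^N: product topology of discrete copies of X, with its Borel sets. *)
Definition seqspace (X : alphabet) : Type :=
  {ptws nat -> discrete_topology X}.

HB.instance Definition _ (X : alphabet) :=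
  Topological.copy (seqspace X) {ptws nat -> discrete_topology X}.
HB.instance Definition _ (X : alphabet) :=
  isPointed.Build (seqspace X) (fun=> symbol_point X).
HB.instance Definition _ (X : alphabet) :=
  Measurable.copy (seqspace X) (g_sigma_algebraType (@open (seqspace X))).

(* The set w X^N of the sequences with prefix w. *)
Definition cylinder (X : alphabet) (w : seq X) : set (seqspace X) :=
  [set omega | mkseq omega (size w) = w].

(* Matrices and row vectors indexed by a finite type I are plain functions
   I -> I -> R and I -> R. *)
Section Stochastic.
Variables (R : realType) (I : finType).
Implicit Types (P : I -> I -> R) (v : I -> R).

Definition stochastic P :=
  (forall i j, 0 <= P i j) /\ (forall i, \sum_j P i j = 1).

Definition mat_mul P Q : I -> I -> R := fun i j => \sum_h P i h * Q h j.

Definition mat_pow P n : I -> I -> R :=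
  iter n (mat_mul P) (fun i j => (i == j)%:R).

Definition irreducible P :=
  forall i j, exists2 n, (0 < n)%N & 0 < mat_pow P n i j.

Definition probability_vector v := (forall i, 0 <= v i) /\ \sum_i v i = 1.

Definition stationary_probability_vector P v :=
  probability_vector v /\ (forall j, \sum_i v i * P i j = v j).

End Stochastic.

(* L_{x w_1} L_{w_1 w_2} ... L_{w_(n-1) w_n} *)
Fixpoint walk_weight (R : realType) (X : alphabet) (L : X -> X -> R)
    (x : X) (w : seq X) : R :=
  if w is y :: w' then L x y * walk_weight L y w' else 1.

Definition markov_measure (R : realType) (X : alphabet) (L : X -> X -> R)
    (l : X -> R) (mu : probability (seqspace X) R) :=
  forall (x : X) (w : seq X),
    mu (cylinder (x :: w)) = (l x * walk_weight L x w)%:E.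

Definition singular d (T : measurableType d) (R : realType)
    (mu nu : set T -> \bar R) :=
  exists A B : set T, [/\ measurable A, measurable B, A `&` B = set0,
    mu (~` A) = 0%E & nu (~` B) = 0%E].

(* Measures in the library are functions on all sets, whose values outside of
   the sigma-algebra are irrelevant. *)
Definition same_measure d (T : measurableType d) (R : realType)
    (mu nu : set T -> \bar R) :=
  forall E : set T, measurable E -> mu E = nu E.

Record automaton (X : alphabet) := Automaton {
  state :> finType;
  card_state_gt0 : (0 < #|state|)%N;
  trans : state -> X -> state;
  output : state -> X -> X }.

Section Automaton.
Variables (X : alphabet) (A : automaton X).

Definition trans_word (s : A) (w : seq X) : A := foldl (@trans X A) s w.

Fixpoint run (s : A) (omega : seqspace X) (n : nat) : A :=
  if n is m.+1 then trans (run s omega m) (omega m) else s.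

Definition action (s : A) (omega : seqspace X) : seqspace X :=
  fun n => output (run s omega n) (omega n).

Definition generated (g : seqspace X -> seqspace X) :=
  exists s : A, g = action s.

Variables (R : realType) (L : X -> X -> R) (l : X -> R).

Definition strongly_connected :=
  forall (s r : A) (x y : X), exists w : seq X,
    trans_word s (x :: w) = r /\
    path (fun a b => L a b != 0) x (rcons w y).

Definition T_matrix (p q : A * X) : R :=
  if trans p.1 p.2 == q.1 then L p.2 q.2 else 0.

Definition K_matrix (s0 s1 : A) : R := \sum_(x : X | trans s0 x == s1) l x.

Definition tensor (k : A -> R) (p : A * X) : R := k p.1 * l p.2.

End Automaton.

(* Main.v *)
Require Import Defs.
From HB Require Import structures.
From mathcomp Require Import all_boot all_order all_algebra.
From mathcomp Require Import all_classical all_reals all_analysis.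
From mathcomp Require Import zify ring lra.

Set Implicit Arguments.
Unset Strict Implicit.
Unset Printing Implicit Defensive.

(** Let g be the action of the state s.  Along a sequence omega with law mu,
    the pairs (state, letter) read by the automaton form a Markov chain with
    matrix T, which is irreducible because the automaton is L-strongly
    connected.  Occurrences of a two-letter word ab in omega, and in g omega,
    are both sums of a function of consecutive states of this chain, so they
    have deterministic asymptotic frequencies.  Since t = k (x) l, in the
    stationary regime the state and the input are independent; the frequency
    of ab in omega is m(ab) = l_a L_ab, and in g omega it is the average of
    the m-masses of the preimages of ab under the states, weighted by k.

    If the two frequencies differ for some ab, then mu and g_* mu are
    concentrated on sequences with different behaviour, hence singular
    ([singular_of_frequency]).  A weak law of large numbers is enough for
    that: deviations of probability O(1/n) are summable along n = 2^j, and
    Borel-Cantelli applies.  The O(1/n) bound comes from Poisson's equation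
    f = u - P u for the irreducible chain ([poisson_equation]), which writes a
    centred additive functional as a martingale plus a bounded term.

    If all the frequencies agree, then m is the k-average of its images under
    the permutations sigma_r of X x X induced by the states r.  The
    permutations preserve the sum of squares of m and every k_r is positive,
    so strict convexity of the square forces m to be invariant under each
    sigma_r ([averaged_rearrangement]).  Summing out the second letter, l and
    then L are invariant too; hence g preserves the weight of every word,
    and mu and g_* mu agree on cylinders. *)

Import Order.TTheory GRing.Theory Num.Theory.

Local Open Scope classical_set_scope.
Local Open Scope ring_scope.

(** * Irreducible finite chains and Poisson's equation *)

Section IrreducibleChain.
Variables (R : realType) (I : finType) (P : I -> I -> R).
Hypothesis P_stochastic : stochastic P.
Hypothesis P_connected : forall i j, connect (fun a b => P a b != 0) i j.

(** Irreducibility is used in this form only: a property inherited along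
    transitions of nonzero probability spreads from one state to all. *)
Lemma step_closed_total (Q : I -> Prop) i j :
  (forall a b, P a b != 0 -> Q a -> Q b) -> Q i -> Q j.
Proof.
move=> Qstep; have /connectP[w] := P_connected i j.
elim: w i => [|a w IHw] i /=; first by move=> _ ->.
by move=> /andP[Pia pw] jE Qi; apply: IHw pw jE _; apply: Qstep Pia Qi.
Qed.

Lemma stationary_gt0 p : stationary_probability_vector P p ->
  forall i, 0 < p i.
Proof.
move=> [[p_ge0 p_sum] p_stat] j.
have [i pi_gt0] : exists i, 0 < p i.
  apply/existsP; apply: contraPT p_sum => /existsPn p_le0.
  rewrite big1 => [|i _]; first by apply/eqP; rewrite eq_sym oner_eq0.
  by apply/eqP; rewrite eq_le p_ge0 leNgt p_le0.
apply: (step_closed_total (Q := fun i => 0 < p i)) pi_gt0 => a b Pab pa.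
rewrite -p_stat (bigD1 a)//= ltr_pwDl //.
  by rewrite mulr_gt0 // lt0r Pab P_stochastic.1.
by apply: sumr_ge0 => c _; rewrite mulr_ge0 // P_stochastic.1.
Qed.

(** Maximum principle: at a maximum of u, the value u i is an average of values
    that are at most u i, so every successor is again a maximum. *)
Lemma harmonic_const (u : I -> R) :
  (forall i, u i = \sum_j P i j * u j) -> forall i j, u i = u j.
Proof.
move=> u_harm i0.
suff [m um] : exists m, forall i, u i = u m by move=> j; rewrite !um.
exists [arg max_(m > i0) u m]%O.
case: Order.TotalTheory.arg_maxP => // m _ u_max i.
have u_le j : u j <= u m by exact: u_max.
apply: (step_closed_total (Q := fun i => u i = u m) (i := m)) => // a b Pab ua.
have gap : \sum_j P a j * (u m - u j) = 0.
  under eq_bigr do rewrite mulrBr.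
  by rewrite sumrB -mulr_suml P_stochastic.2 mul1r -u_harm ua subrr.
have terms_ge0 j : true -> 0 <= P a j * (u m - u j).
  by move=> _; rewrite mulr_ge0 ?P_stochastic.1 // subr_ge0 u_le.
have /eqP := psumr_eq0P terms_ge0 gap (i := b) isT.
by rewrite mulf_eq0 (negPf Pab) /= subr_eq0 eq_sym => /eqP.
Qed.

(** By the maximum principle the kernel of 1 - P is the line of constants, so
    its image is a hyperplane; that image lies in the hyperplane orthogonal to
    p, hence equals it.  Functions are encoded as row vectors v, and M is the
    transpose of 1 - P, so that v *m M represents v - P v. *)
Lemma poisson_equation p (f : I -> R) : stationary_probability_vector P p ->
  \sum_i p i * f i = 0 ->
  exists u : I -> R, forall i, f i = u i - \sum_j P i j * u j.
Proof.
move=> p_stat pf0.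
have p_pos := stationary_gt0 p_stat.
pose n := #|I|.
pose M : 'M[R]_n :=
  \matrix_(j, i) ((i == j)%:R - P (enum_val i) (enum_val j)).
pose pc : 'cV[R]_n := \col_i p (enum_val i).
have sum_enum (F : I -> R) : \sum_i F i = \sum_(a < n) F (enum_val a).
  by rewrite (reindex _ (onW_bij _ (@enum_val_bij I))).
have mulM (v : 'rV[R]_n) i :
    (v *m M) 0 i = v 0 i - \sum_a P (enum_val i) (enum_val a) * v 0 a.
  rewrite mxE.
  under eq_bigr do rewrite mxE mulrBr.
  rewrite sumrB; congr (_ - _); last by apply: eq_bigr => a _; rewrite mulrC.
  rewrite (bigD1 i)//= eqxx mulr1 big1 ?addr0 // => a.
  by rewrite eq_sym => /negPf ->; rewrite mulr0.
have [n0|n_gt0] := posnP n.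
  by exists (fun=> 0) => i; have /card0_eq/(_ i) := n0; rewrite inE.
have rank_kerM : (\rank (kermx M) <= 1)%N.
  apply: leq_trans (rank_leq_row (const_mx 1 : 'rV[R]_n)).
  apply: mxrankS; apply/row_subP => k.
  have : row k (kermx M) *m M = 0 by apply/sub_kermxP; rewrite row_sub.
  move: (row k _) => v vM0.
  have v_const a b : v 0 a = v 0 b.
    have := harmonic_const (u := fun i => v 0 (enum_rank i)) _
      (enum_val a) (enum_val b).
    rewrite !enum_valK; apply => i.
    have := mulM v (enum_rank i); rewrite vM0 mxE enum_rankK => /eqP.
    rewrite eq_sym subr_eq0 => /eqP ->; rewrite sum_enum.
    by apply: eq_bigr => c _; rewrite enum_valK.
  have -> : v = v 0 (Ordinal n_gt0) *: const_mx 1.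
    by apply/rowP => a; rewrite !mxE mulr1; apply: (v_const a).
  exact: scalemx_sub.
have Mpc : M *m pc = 0.
  apply/colP => j; rewrite !mxE.
  under eq_bigr do rewrite !mxE mulrBl.
  rewrite sumrB (bigD1 j)//= eqxx mul1r big1 ?addr0; last first.
    by move=> a /negPf ->; rewrite mul0r.
  under eq_bigr do rewrite mulrC.
  by rewrite -(sum_enum (fun i => p i * P i (enum_val j))) p_stat.2 subrr.
have rank_pc : \rank pc = 1%N.
  apply/eqP; rewrite eqn_leq rank_leq_col lt0n mxrank_eq0.
  apply/eqP => /colP /(_ (Ordinal n_gt0)); rewrite !mxE => p0.
  by have := p_pos (enum_val (Ordinal n_gt0)); rewrite p0 ltxx.
have kerE : (kermx pc <= M)%MS.
  have subM : (M <= kermx pc)%MS by apply/sub_kermxP.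
  rewrite -(geq_leqif (mxrank_leqif_sup subM)) mxrank_ker rank_pc leq_subLR.
  by rewrite addnC -leq_subLR -mxrank_ker.
have /submxP[v vE] : ((\row_i f (enum_val i)) <= M)%MS.
  apply: submx_trans kerE; apply/sub_kermxP/rowP => i.
  rewrite !mxE -[RHS]pf0 sum_enum; apply: eq_bigr => a _.
  by rewrite !mxE mulrC.
exists (fun i => v 0 (enum_rank i)) => i.
have /rowP/(_ (enum_rank i)) := vE; rewrite mxE mulM enum_rankK => ->.
by rewrite sum_enum; congr (_ - _); apply: eq_bigr => a _; rewrite enum_valK.
Qed.

End IrreducibleChain.

(** * Second moment of additive functionals *)

Section ExpectedValue.
Variables (R : realType) (I : finType) (P : I -> I -> R).
Hypothesis P_stochastic : stochastic P.

(** Expectation over the n steps that follow i, computed by conditioning on the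
    first step; the word given to F omits the starting point i. *)
Fixpoint walk_mean (n : nat) (i : I) (F : seq I -> R) : R :=
  if n is m.+1 then \sum_j P i j * walk_mean m j (fun w => F (j :: w))
  else F [::].

Fixpoint walk_sum (h : I -> I -> R) (i : I) (w : seq I) : R :=
  if w is j :: w' then h i j + walk_sum h j w' else 0.

Lemma eq_walk_mean n i F G : F =1 G -> walk_mean n i F = walk_mean n i G.
Proof. by move=> /funext ->. Qed.

Lemma ler_walk_mean n i F G : (forall w, size w = n -> F w <= G w) ->
  walk_mean n i F <= walk_mean n i G.
Proof.
elim: n i F G => [|n IHn] i F G FG /=; first exact: FG.
apply: ler_sum => j _; rewrite ler_wpM2l ?P_stochastic.1 //.
by apply: IHn => w wn; apply: FG => /=; rewrite wn.
Qed.

Lemma walk_meanD n i F G :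
  walk_mean n i (fun w => F w + G w) = walk_mean n i F + walk_mean n i G.
Proof.
elim: n i F G => [|n IHn] i F G //=.
by rewrite -big_split; apply: eq_bigr => j _; rewrite IHn mulrDr.
Qed.

Lemma walk_meanZ n i a F :
  walk_mean n i (fun w => a * F w) = a * walk_mean n i F.
Proof.
elim: n i F => [|n IHn] i F //=.
by rewrite mulr_sumr; apply: eq_bigr => j _; rewrite IHn mulrCA.
Qed.

Lemma walk_mean_cst n i a : walk_mean n i (fun=> a) = a.
Proof.
elim: n i => [|n IHn] i //=.
under eq_bigr do rewrite IHn.
by rewrite -mulr_suml P_stochastic.2 mul1r.
Qed.

Lemma martingale_mean0 D : (forall i, \sum_j P i j * D i j = 0) ->
  forall n i, walk_mean n i (walk_sum D i) = 0.
Proof.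
move=> D0; elim=> [|n IHn] i //=.
under eq_bigr do rewrite walk_meanD walk_mean_cst IHn addr0.
exact: D0.
Qed.

(** Conditioning on the first step, the cross term vanishes because the rest of
    the sum has conditional mean zero; each step therefore adds at most K. *)
Lemma martingale_variance D K : (forall i, \sum_j P i j * D i j = 0) ->
  (forall i j, D i j ^+ 2 <= K) ->
  forall n i, walk_mean n i (fun w => walk_sum D i w ^+ 2) <= n%:R * K.
Proof.
move=> D0 DK; elim=> [|n IHn] i /=; first by rewrite expr0n mul0r.
have -> : n.+1%:R * K = \sum_j P i j * (K + n%:R * K).
  by rewrite -mulr_suml P_stochastic.2 mul1r mulrSr mulrDl mul1r addrC.
apply: ler_sum => j _; rewrite ler_wpM2l ?P_stochastic.1 //.
under eq_walk_mean do rewrite sqrrD -mulrnAl.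
rewrite !walk_meanD (walk_meanZ _ _ (D i j *+ 2)) martingale_mean0 //.
rewrite mulr0 addr0 walk_mean_cst.
exact: lerD.
Qed.

Lemma walk_sumD h1 h2 i w :
  walk_sum (fun a b => h1 a b + h2 a b) i w = walk_sum h1 i w + walk_sum h2 i w.
Proof.
by elim: w i => [|j w IHw] i /=; rewrite ?addr0 // IHw addrACA.
Qed.

Lemma walk_sum_telescope (u : I -> R) i w :
  walk_sum (fun a b => u a - u b) i w = u i - u (last i w).
Proof.
elim: w i => [|j w IHw] i /=; first by rewrite subrr.
by rewrite IHw addrA subrK.
Qed.

Lemma walk_sum_cst (c : R) i w : walk_sum (fun _ _ => c) i w = (size w)%:R * c.
Proof.
elim: w i => [|j w IHw] i /=; first by rewrite mul0r.
by rewrite IHw mulrSr mulrDl mul1r addrC.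
Qed.

Lemma finite_bound (J : finType) (F : J -> R) :
  exists2 K, 0 <= K & forall j, F j <= K.
Proof.
exists (\sum_j `|F j|) => [|j]; first exact: sumr_ge0.
rewrite (bigD1 j) //= (le_trans (ler_norm _)) // lerDl.
exact: sumr_ge0.
Qed.

(** With u solving Poisson's equation for the conditional mean of h minus c, the
    increments h i j - c - u i + u j have conditional mean zero, and the
    remaining part u i - u j telescopes to a bounded term. *)
Lemma walk_sum_variance p h :
  (forall i j, connect (fun a b => P a b != 0) i j) ->
  stationary_probability_vector P p ->
  let c := \sum_i p i * \sum_j P i j * h i j in
  exists2 K, 0 <= K & forall n i,
    walk_mean n i (fun w => (walk_sum h i w - n%:R * c) ^+ 2) <= n.+1%:R * K.
Proof.
move=> P_conn p_stat c.
have [|u uE] := poisson_equation P_stochastic P_conn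
    (f := fun i => \sum_j P i j * h i j - c) p_stat.
  under eq_bigr do rewrite mulrBr.
  by rewrite sumrB -mulr_suml p_stat.1.2 mul1r subrr.
pose D i j := h i j - c - u i + u j.
have D0 i : \sum_j P i j * D i j = 0.
  rewrite /D; under eq_bigr do rewrite !(mulrDr, mulrN).
  rewrite 3!big_split /= !sumrN -!mulr_suml P_stochastic.2 !mul1r.
  by have := uE i; lra.
have [K1 K1_ge0 DK1] := finite_bound (fun q : I * I => D q.1 q.2 ^+ 2).
have [K2 K2_ge0 uK2] := finite_bound (fun q : I * I => (u q.1 - u q.2) ^+ 2).
exists (2 * (K1 + K2)) => [|n i]; first lra.
have decomp w : size w = n ->
    (walk_sum h i w - n%:R * c) ^+ 2 <= 2 * walk_sum D i w ^+ 2 + 2 * K2.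
  move=> wn; have -> : walk_sum h i w - n%:R * c =
      walk_sum D i w + (u i - u (last i w)).
    rewrite -walk_sum_telescope -walk_sumD -wn -mulrN -(walk_sum_cst _ i).
    rewrite -!walk_sumD; congr walk_sum.
    by apply/funext => a; apply/funext => b; rewrite /D /=; ring.
  have := uK2 (i, last i w); rewrite /=.
  move: (walk_sum D i w) (u i - _) => a b b_le.
  have : 0 <= (a - b) ^+ 2 by exact: sqr_ge0.
  by rewrite sqrrB sqrrD; lra.
apply: le_trans (ler_walk_mean _ decomp) _.
rewrite walk_meanD walk_meanZ walk_mean_cst.
have := martingale_variance D0 (fun a b => DK1 (a, b)) n i.
have : 0 <= n%:R * K2 by rewrite mulr_ge0.
by rewrite mulrSr; lra.
Qed.

End ExpectedValue.

(** * Cylinders and Markov measures *)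

Section SequenceSpace.
Variable X : alphabet.
Implicit Types (omega : seqspace X) (w : seq X).

Definition prefix_set (n : nat) (Q : pred (seq X)) : set (seqspace X) :=
  [set omega | Q (mkseq omega n)].

Lemma nbhs_prefix omega n :
  nbhs omega [set omega' : seqspace X | mkseq omega' n = mkseq omega n].
Proof.
elim: n => [|n IHn]; first exact: filterE.
have near_letter : nbhs omega [set omega' : seqspace X | omega' n = omega n].
  exact: (@proj_continuous nat (fun=> discrete_topology X) n omega _
    (discrete_set1 (omega n : discrete_topology X))).
apply: filterS2 IHn near_letter => omega' /= IH E.
by rewrite !mkseqS IH E.
Qed.

Lemma prefix_set_open n Q : open (prefix_set n Q).
Proof.
rewrite openE => omega Qomega.
by apply: filterS (nbhs_prefix omega n) => omega'; rewrite /prefix_set /= => ->.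
Qed.

Lemma prefix_set_measurable n Q : measurable (prefix_set n Q).
Proof. by apply: sub_sigma_algebra; exact: prefix_set_open. Qed.

Lemma cylinderE w : cylinder w = prefix_set (size w) (pred1 w).
Proof. by apply/seteqP; split => omega /eqP. Qed.

Lemma cylinder_measurable w : measurable (cylinder w : set (seqspace X)).
Proof. by rewrite cylinderE; exact: prefix_set_measurable. Qed.

(** If no prefix worked, points outside U sharing longer and longer prefixes
    with omega would converge to omega. *)
Lemma cylinder_sub_open (U : set (seqspace X)) omega : open U -> U omega ->
  exists n, cylinder (mkseq omega n) `<=` U.
Proof.
move=> Uopen Uomega; apply: contrapT => noprefix.
have escape n : exists omega', mkseq omega' n = mkseq omega n /\ ~ U omega'.
  apply: contrapT => noescape; apply: noprefix; exists n => omega' /=.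
  rewrite /cylinder /= size_mkseq => E; apply: contrapT => nU.
  by apply: noescape; exists omega'.
have [phi phiP] := choice escape.
have : phi @ \oo --> (omega : seqspace X).
  apply/cvg_sup => m; apply/cvg_image; first by apply/seteqP; split => // y _;
    exists (fun=> y).
  move=> V /= Vm; exists (proj m @^-1` V); last first.
    by apply: image_preimage; apply/seteqP; split=> // y _; exists (fun=> y).
  exists m.+1 => // n /= mn; rewrite /proj.
  have -> : phi n m = omega m.
    have /(congr1 (nth (symbol_point X) ^~ m)) := (phiP n).1.
    by rewrite !nth_mkseq.
  exact: nbhs_singleton.
move=> /(_ U (open_nbhs_nbhs (conj Uopen Uomega))) [N _ /(_ N (leqnn N))].
by case: (phiP N).
Qed.

(** The empty set is added to make the family stable under intersection. *)
Definition cylinders : set (set (seqspace X)) :=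
  [set C | C = set0 \/ exists w, C = cylinder w].

(** There are countably many words, so an open set, being a union of cylinders,
    is a countable one. *)
Lemma measurable_cylinders :
  (measurable : set (set (seqspace X))) = <<s cylinders >>.
Proof.
apply/seteqP; split; last first.
  apply: smallest_sub; first exact: sigma_algebra_measurable.
  by move=> C [->|[w ->]]; [exact: measurable0 | exact: cylinder_measurable].
apply: smallest_sub; first exact: smallest_sigma_algebra.
move=> U Uopen.
have -> : U = \bigcup_(w : seq X)
    (if `[< cylinder w `<=` U >] then cylinder w else set0).
  apply/seteqP; split => [omega /(cylinder_sub_open Uopen)[n cU]|].
    exists (mkseq omega n) => //.
    by rewrite asboolT //= /cylinder /= size_mkseq.
  by move=> omega [w _]; case: asboolP => // wU /wU.
apply: (@countable_bigcupT_measurable _ (g_sigma_algebraType cylinders)).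
  exact: countableP.
move=> w; apply: sub_sigma_algebra.
by case: asboolP => _; [right; exists w | left].
Qed.

(** Two words are either prefix-comparable, and the cylinder of the longer one
    is the smaller, or their cylinders are disjoint. *)
Lemma cylinders_setI : setI_closed cylinders.
Proof.
move=> C D [->|[v ->]]; first by rewrite set0I; left.
case=> [->|[w ->]]; first by rewrite setI0; left.
wlog: v w / (size v <= size w)%N.
  by case: (leqP (size v) (size w)) => [vw /(_ v w vw)//|/ltnW wv /(_ w v wv)];
    rewrite setIC.
move=> vw; have [wE|wN] := eqVneq (take (size v) w) v; [right; exists w|left].
  apply/seteqP; split => [omega []//|omega /= wP]; split => //.
  rewrite /cylinder /= in wP *; rewrite -[RHS]wE -wP /mkseq -map_take take_iota.
  by rewrite (minn_idPl vw).
rewrite -subset0 => omega [/= vP wP]; move/eqP: wN; apply.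
rewrite /cylinder /= in vP wP; rewrite -wP -[RHS]vP /mkseq -map_take take_iota.
by rewrite (minn_idPl vw).
Qed.

Lemma measurable_fun_prefix (g : seqspace X -> seqspace X) :
  (forall w, measurable (g @^-1` cylinder w)) -> measurable_fun setT g.
Proof.
move=> mg; apply: (measurability cylinders measurable_cylinders) => _ [C + <-].
rewrite setTI => -[->|[w ->]//]; by rewrite preimage_set0.
Qed.

Lemma same_measure_cylinders (R : realType)
    (m1 m2 : {measure set (seqspace X) -> \bar R}) :
  (m1 setT < +oo)%E ->
  (forall w, m1 (cylinder w) = m2 (cylinder w)) -> same_measure m1 m2.
Proof.
move=> m1_fin m12 E mE.
have cyl_nil : cylinder [::] = [set: seqspace X].
  by apply/seteqP; split.
apply: (measure_unique cylinders (fun=> cylinder [::])) => //.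
- exact: measurable_cylinders.
- exact: cylinders_setI.
- by move=> _; right; exists [::].
- by rewrite bigcup_const // cyl_nil.
- by move=> C [->|[w ->]//]; rewrite !measure0.
- by move=> _; rewrite cyl_nil.
Qed.

Lemma measure_split_letter (R : realType)
    (m : {measure set (seqspace X) -> \bar R}) w (E : set (seqspace X)) :
  measurable E ->
  m (cylinder w `&` E) = (\sum_x m (cylinder (rcons w x) `&` E))%E.
Proof.
move=> mE.
have -> : cylinder w `&` E =
    \bigcup_(x in [set` enum X]) (cylinder (rcons w x) `&` E).
  apply/seteqP; split => [omega [wP Eomega]|omega [x _ [xP Eomega]]].
    exists (omega (size w)); first by rewrite /= mem_enum.
    by split=> //; rewrite /cylinder /= size_rcons mkseqS wP.
  split=> //; move: xP; rewrite /cylinder /= size_rcons mkseqS.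
  by move/rcons_inj => [].
rewrite measure_fin_bigcup //.
- by rewrite -fsbig_seq ?enum_uniq // big_enum.
- move=> x y _ _ [omega [[xP _] [yP _]]]; move: xP yP.
  by rewrite /cylinder /= !size_rcons => -> /rcons_inj [].
- by move=> x _; apply: measurableI => //; exact: cylinder_measurable.
Qed.

End SequenceSpace.

Lemma walk_weight_rcons (R : realType) (X : alphabet) (L : X -> X -> R) x w y :
  walk_weight L x (rcons w y) = walk_weight L x w * L (last x w) y.
Proof.
by elim: w x => [|z w IHw] x /=; rewrite ?mulr1 ?mul1r // IHw mulrA.
Qed.

Section MarkovMeasure.
Variables (R : realType) (X : alphabet) (L : X -> X -> R) (l : X -> R).
Variable mu : probability (seqspace X) R.
Hypothesis mu_markov : markov_measure L l mu.

(** Splitting the cylinder according to the next letter reproduces the recursion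
    that defines [walk_mean]. *)
Lemma markov_cylinder_prefix Q n x w :
  mu (cylinder (x :: w) `&` prefix_set (size w + n).+1 Q) =
  (l x * walk_weight L x w *
   walk_mean L n (last x w) (fun v => (Q (x :: w ++ v))%:R))%:E.
Proof.
elim: n w => [|n IHn] w.
  rewrite /= cats0 addn0; case: (boolP (Q (x :: w))) => Qw.
    rewrite mulr1 -mu_markov; congr (mu _).
    by apply/seteqP; split => [omega []//|omega wP]; split => //;
      rewrite /prefix_set /= (wP : mkseq _ _ = _).
  rewrite mulr0 [X in mu X](_ : _ = set0) ?measure0 //.
  rewrite -subset0 => omega [wP]; rewrite /prefix_set /= (wP : mkseq _ _ = _).
  exact/negP.
rewrite measure_split_letter; last exact: prefix_set_measurable.
rewrite /= mulr_sumr -sumEFin; apply: eq_bigr => y _.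
have := IHn (rcons w y); rewrite size_rcons addSnnS => ->.
rewrite walk_weight_rcons last_rcons; congr (_%:E).
rewrite -!mulrA; do 3 congr (_ * _).
by apply: eq_walk_mean => v; rewrite cat_rcons.
Qed.

Lemma markov_prefix Q n :
  mu (prefix_set n.+1 Q) =
  (\sum_x l x * walk_mean L n x (fun w => (Q (x :: w))%:R))%:E.
Proof.
have -> : prefix_set n.+1 Q = cylinder [::] `&` prefix_set n.+1 Q.
  by rewrite (_ : cylinder [::] = setT) ?setTI //; apply/seteqP; split.
rewrite measure_split_letter; last exact: prefix_set_measurable.
rewrite -sumEFin; apply: eq_bigr => x _.
by have := markov_cylinder_prefix Q n x [::]; rewrite /= mulr1.
Qed.

End MarkovMeasure.

(** By Borel-Cantelli, m1-almost every point is in B j for all large j, whereas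
    m2-almost every point is in only finitely many B j. *)
Lemma singular_criterion d (T : measurableType d) (R : realType)
    (m1 m2 : {measure set T -> \bar R}) (B : (set T)^nat) (K : R) :
  0 <= K -> (forall j, measurable (B j)) ->
  (forall j, (m1 (~` B j) <= (K / (2 ^ j.+1)%:R)%:E)%E) ->
  (forall j, (m2 (B j) <= (K / (2 ^ j.+1)%:R)%:E)%E) ->
  singular m1 m2.
Proof.
move=> K_ge0 mB m1B m2B.
have mBC j : measurable (~` B j) by exact: measurableC.
have null (m : {measure set T -> \bar R}) (F : (set T)^nat) :
    (forall j, measurable (F j)) ->
    (forall j, (m (F j) <= (K / (2 ^ j.+1)%:R)%:E)%E) ->
    m (lim_sup_set F) = 0%E.
  move=> mF mFK; apply: lim_sup_set_cvg0 => //.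
  apply: le_lt_trans (ltry K).
  apply: le_trans (epsilon_trick0 xpredT K_ge0).
  by apply: lee_nneseries => [j _ _|j _]; [exact: measure_ge0 | exact: mFK].
have mlimsup F : (forall j, measurable (F j)) ->
    measurable (lim_sup_set F : set T).
  move=> mF; apply: bigcapT_measurable => n.
  by apply: bigcup_measurable => j _; exact: mF.
exists (~` lim_sup_set (fun j => ~` B j)), (lim_sup_set (fun j => ~` B j)).
split.
- by apply: measurableC; exact: mlimsup.
- exact: mlimsup.
- by rewrite setICl.
- by rewrite setCK; exact: null.
- apply/eqP; rewrite eq_le measure_ge0 andbT -(null m2 B mB m2B).
  apply: le_measure; rewrite ?inE; [|exact: mlimsup|].
    by apply: measurableC; exact: mlimsup.
  (* a point outside limsup (~` B) is in B j from some rank on *)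
  move=> x; rewrite /lim_sup_set setC_bigcap => -[N _].
  rewrite setC_bigcup => xB.
  move=> n _; exists (maxn n N); first exact: leq_maxl.
  by have := xB (maxn n N) (leq_maxr _ _); rewrite setCK.
Qed.

(** * A weak law of large numbers *)

Lemma walk_sum_map (R : realType) (I J : finType) (f : J -> I) h j w :
  walk_sum h (f j) (map f w) =
  walk_sum (fun a b => h (f a) (f b)) j w :> R.
Proof. by elim: w j => [|b w IHw] j //=; rewrite IHw. Qed.

(** Meant for words of n.+1 letters, which have n transitions: the event that
    Chebyshev's inequality bounds. *)
Definition deviant (R : realType) (I : finType) (h : I -> I -> R) (c e : R)
    (n : nat) : pred (seq I) :=
  fun w => if w is i :: w' then n%:R * e <= `|walk_sum h i w' - n%:R * c|
           else false.

Lemma deviant_map (R : realType) (I J : finType) (f : J -> I)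
    (h : I -> I -> R) c e n w :
  deviant h c e n (map f w) = deviant (fun a b => h (f a) (f b)) c e n w.
Proof. by case: w => [|j w] //=; rewrite walk_sum_map. Qed.

Lemma walk_chebyshev (R : realType) (I : finType) (P : I -> I -> R) p h e :
  stochastic P -> (forall i j, connect (fun a b => P a b != 0) i j) ->
  stationary_probability_vector P p -> 0 < e ->
  let c := \sum_i p i * \sum_j P i j * h i j in
  exists2 K, 0 <= K & forall n i, (0 < n)%N ->
    walk_mean P n i (fun w => (deviant h c e n (i :: w))%:R) <= K / n%:R.
Proof.
move=> P_stoch P_conn p_stat e_gt0 c.
have [K K_ge0 KP] := walk_sum_variance P_stoch h P_conn p_stat.
exists (2 * K / e ^+ 2) => [|n i n_gt0].
  by rewrite divr_ge0 ?sqr_ge0 ?mulr_ge0.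
have ne_gt0 : 0 < (n%:R * e) ^+ 2 :> R.
  by rewrite exprn_gt0 // mulr_gt0 // ltr0n.
have markov w : (deviant h c e n (i :: w))%:R <=
    ((n%:R * e) ^+ 2)^-1 * (walk_sum h i w - n%:R * c) ^+ 2.
  case: (boolP (deviant _ _ _ _ _)) => [far|_]; last first.
    by apply: mulr_ge0; [rewrite invr_ge0 ltW|exact: sqr_ge0].
  rewrite -[leLHS](mulVf (lt0r_neq0 ne_gt0))
    ler_wpM2l ?(ltW ne_gt0) ?invr_ge0 ?(ltW ne_gt0) //.
  rewrite -[leRHS]ger0_norm ?sqr_ge0 // normrX lerXn2r ?nnegrE //.
  by rewrite mulr_ge0 // ltW.
apply: le_trans (ler_walk_mean P_stoch _ (fun w _ => markov w)) _.
rewrite walk_meanZ ler_pdivrMl //.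
apply: le_trans (KP n i) _.
have -> : (n%:R * e) ^+ 2 * (2 * K / e ^+ 2 / n%:R) = (2 * n%:R) * K.
  by field; rewrite lt0r_neq0 ?ltr0n //= lt0r_neq0.
rewrite ler_wpM2r // -natrM ler_nat; lia.
Qed.

(** * The chain of states and letters *)

Section Annotation.
Variables (X : alphabet) (A : automaton X).
Implicit Types (r s : A) (w : seq X) (omega : seqspace X).

(** The trajectory of the chain with matrix T.  Both the input word and the
    output word are images of it under a letter-to-letter map, so that one law
    of large numbers for this chain serves both. *)
Fixpoint annotate r w : seq (A * X) :=
  if w is x :: w' then (r, x) :: annotate (trans r x) w' else [::].

Definition emit (p : A * X) : X := output p.1 p.2.

Lemma annotateK r w : map snd (annotate r w) = w.
Proof. by elim: w r => [|x w IHw] r //=; rewrite IHw. Qed.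

Lemma size_annotate r w : size (annotate r w) = size w.
Proof. by rewrite -[in RHS](annotateK r w) size_map. Qed.

Lemma annotate_rcons r w x :
  annotate r (rcons w x) = rcons (annotate r w) (trans_word r w, x).
Proof. by elim: w r => [|y w IHw] r //=; rewrite IHw. Qed.

Lemma run_prefix s omega n : run s omega n = trans_word s (mkseq omega n).
Proof.
elim: n => // n IHn.
by rewrite mkseqS /trans_word foldl_rcons -/(trans_word _ _) -IHn.
Qed.

Lemma action_prefix s omega n :
  mkseq (action s omega) n = map emit (annotate s (mkseq omega n)).
Proof.
elim: n => // n IHn.
by rewrite !mkseqS IHn annotate_rcons map_rcons /action run_prefix.
Qed.

Lemma action_preimage s n Q :
  action s @^-1` prefix_set n Q =
  prefix_set n (fun w => Q (map emit (annotate s w))).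
Proof.
by apply/seteqP; split=> omega; rewrite /prefix_set /= action_prefix.
Qed.

Lemma measurable_action s : measurable_fun setT (action s).
Proof.
apply: measurable_fun_prefix => w.
by rewrite cylinderE action_preimage; exact: prefix_set_measurable.
Qed.

Section Surjective.
Variable s : A.
Hypothesis s_surj : forall omega, exists omega', action s omega' = omega.

Lemma emit_surj w :
  exists2 w', size w' = size w & map emit (annotate s w') = w.
Proof.
have [omega E] := s_surj (fun n => nth (symbol_point X) w n).
exists (mkseq omega (size w)); first by rewrite size_mkseq.
by rewrite -action_prefix E; exact: mkseq_nth.
Qed.

(** A surjective self-map of the finite set of words of length n is injective,
    so surjectivity of the action on infinite sequences gives injectivity on
    finite words. *)
Lemma emit_inj v w : size v = size w ->
  map emit (annotate s v) = map emit (annotate s w) -> v = w.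
Proof.
move=> vw; pose n := size w.
have emit_size (t : n.-tuple X) : size (map emit (annotate s t)) == n.
  by rewrite size_map size_annotate size_tuple.
pose f (t : n.-tuple X) : n.-tuple X := Tuple (emit_size t).
have /choice[f' f'K] : forall t, exists t', f t' = t.
  move=> t; have [w' w't E] := emit_surj t.
  have w'n : size w' == n by rewrite w't size_tuple.
  by exists (Tuple w'n); apply: val_inj.
have f_inj : injective f.
  apply: bij_inj; apply: (bij_can_bij (injF_bij (can_inj f'K)) f'K).
move=> E; have vn : size v == n by rewrite vw.
have wn : size w == n by [].
have fE : f (Tuple vn) = f (Tuple wn) by apply: val_inj.
by have /(congr1 val) := f_inj _ _ fE.
Qed.

Lemma output_inj v : injective (output (trans_word s v)).
Proof.
move=> x y E; have : rcons v x = rcons v y.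
  apply: emit_inj; first by rewrite !size_rcons.
  by rewrite !annotate_rcons !map_rcons /emit /= E.
by move/rcons_inj => [].
Qed.

Lemma action_cylinder w :
  action s @^-1` cylinder (map emit (annotate s w)) = cylinder w.
Proof.
rewrite cylinderE action_preimage size_map size_annotate.
apply/seteqP; split=> omega; rewrite /prefix_set /cylinder /=.
  by move/eqP; apply: emit_inj; rewrite size_mkseq.
by move=> ->.
Qed.

End Surjective.

Section Product.
Variables (R : realType) (L : X -> X -> R).

Lemma sum_T_matrix r x (F : A * X -> R) :
  \sum_q T_matrix L (r, x) q * F q = \sum_y L x y * F (trans r x, y).
Proof.
transitivity (\sum_s \sum_y T_matrix L (r, x) (s, y) * F (s, y)).
  by rewrite pair_bigA; apply: eq_bigr => -[].
rewrite (bigD1 (trans r x)) //= [X in _ + X]big1 ?addr0.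
  by apply: eq_bigr => y _; rewrite /T_matrix /= eqxx.
move=> s sN; apply: big1 => y _.
by rewrite /T_matrix /= eq_sym (negPf sN) mul0r.
Qed.

Lemma T_matrix_stochastic : stochastic L -> stochastic (@T_matrix X A R L).
Proof.
move=> [L_ge0 L_sum]; split=> [p q|[r x]].
  by rewrite /T_matrix; case: ifP.
rewrite -[RHS](L_sum x) -[LHS]/(\sum_q T_matrix L (r, x) q).
under eq_bigr do rewrite -[T_matrix _ _ _]mulr1.
by rewrite sum_T_matrix; apply: eq_bigr => y _; rewrite mulr1.
Qed.

(** The chain T moves its state deterministically, so averaging over its walks
    is averaging over the letters alone. *)
Lemma walk_mean_T_matrix n r x (F : seq (A * X) -> R) :
  walk_mean (T_matrix L) n (r, x) F =
  walk_mean L n x (fun w => F (annotate (trans r x) w)).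
Proof.
elim: n r x F => //= n IHn r x F.
by rewrite sum_T_matrix; apply: eq_bigr => y _; rewrite IHn.
Qed.

Lemma T_matrix_connected : strongly_connected A L ->
  forall p q : A * X, connect (fun a b => T_matrix L a b != 0) p q.
Proof.
move=> A_conn [s x] [r y].
have [w [<- pw]] := A_conn s r x y.
apply/connectP; exists (annotate (trans s x) (rcons w y)); last first.
  by rewrite annotate_rcons last_rcons.
elim: {w}(rcons w y) s x pw => //= z w IHw s x /andP[Lxz pw].
by rewrite {1}/T_matrix /= eqxx Lxz IHw.
Qed.

Variables (l : X -> R) (mu : probability (seqspace X) R).
Hypothesis L_stochastic : stochastic L.
Hypothesis l_prob : probability_vector l.
Hypothesis mu_markov : markov_measure L l mu.
Hypothesis A_connected : strongly_connected A L.

Lemma weak_law_large_numbers t h e s :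
  stationary_probability_vector (T_matrix L) t -> 0 < e ->
  let c := \sum_p t p * \sum_q T_matrix L p q * h p q in
  exists2 K, 0 <= K & forall n, (0 < n)%N ->
    (mu (prefix_set n.+1 (fun w => deviant h c e n (annotate s w))) <=
     (K / n%:R)%:E)%E.
Proof.
move=> t_stat e_gt0 c.
have [K K_ge0 KP] := walk_chebyshev h (T_matrix_stochastic L_stochastic)
  (T_matrix_connected A_connected) t_stat e_gt0.
exists K => // n n_gt0.
rewrite (markov_prefix mu_markov) lee_fin.
have -> : K / n%:R = \sum_x l x * (K / n%:R).
  by rewrite -mulr_suml l_prob.2 mul1r.
apply: ler_sum => x _; rewrite ler_wpM2l ?l_prob.1 //.
by have := KP n (s, x) n_gt0; rewrite walk_mean_T_matrix.
Qed.

End Product.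
End Annotation.
Arguments emit {X A}.

(** Equality case of a variance inequality: expanding the squares, the k-average
    of sum_p (m (sigma_s p) - m p)^2 is 2 sum m^2 minus twice the k-average of
    sum_p m p * m (sigma_s p); the averaging hypothesis turns the latter into
    sum m^2, so the total is zero and so is each term. *)
Lemma averaged_rearrangement (R : realType) (J S : finType) (k : S -> R)
    (m : J -> R) (sigma : S -> J -> J) :
  (forall s, 0 < k s) -> \sum_s k s = 1 -> (forall s, injective (sigma s)) ->
  (forall q, \sum_s k s * \sum_p m p * (sigma s p == q)%:R = m q) ->
  forall s p, m (sigma s p) = m p.
Proof.
move=> k_gt0 k_sum sigma_inj avg.
have mean_cross : \sum_s k s * \sum_p m p * m (sigma s p) = \sum_q m q ^+ 2.
  transitivity (\sum_q m q * \sum_s k s * \sum_p m p * (sigma s p == q)%:R).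
    under [RHS]eq_bigr do rewrite mulr_sumr.
    rewrite exchange_big /=; apply: eq_bigr => s _.
    under [RHS]eq_bigr do rewrite mulrCA mulr_sumr.
    rewrite -mulr_sumr exchange_big /=; congr (_ * _); apply: eq_bigr => p _.
    rewrite (bigD1 (sigma s p)) //= eqxx mulr1 big1 ?addr0 1?mulrC // => q.
    by rewrite eq_sym => /negPf ->; rewrite !mulr0.
  by apply: eq_bigr => q _; rewrite avg expr2.
have gap0 : \sum_s k s * \sum_p (m (sigma s p) - m p) ^+ 2 = 0.
  transitivity (\sum_s (k s * (2 * \sum_q m q ^+ 2) -
      2 * (k s * \sum_p m p * m (sigma s p)))).
    apply: eq_bigr => s _.
    have -> : \sum_p (m (sigma s p) - m p) ^+ 2 =
        \sum_p m (sigma s p) ^+ 2 + \sum_p m p ^+ 2 -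
        2 * \sum_p m p * m (sigma s p).
      rewrite mulr_sumr -big_split -sumrB; apply: eq_bigr => p _ /=.
      by ring.
    by rewrite -(reindex_inj (sigma_inj s) (P := xpredT)
      (F := fun q => m q ^+ 2)) /=; ring.
  by rewrite sumrB -mulr_suml k_sum -mulr_sumr mean_cross mul1r subrr.
move=> s p.
have sq_ge0 s' : 0 <= \sum_p (m (sigma s' p) - m p) ^+ 2.
  by apply: sumr_ge0 => q _; exact: sqr_ge0.
have /eqP := psumr_eq0P (fun s' _ => mulr_ge0 (ltW (k_gt0 s')) (sq_ge0 s'))
  gap0 (i := s) isT.
rewrite mulf_eq0 (gt_eqF (k_gt0 s)) /= => /eqP sum0.
have /eqP := psumr_eq0P (fun q _ => sqr_ge0 (m (sigma s q) - m q)) sum0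
  (i := p) isT.
by rewrite sqrf_eq0 subr_eq0 => /eqP.
Qed.

Lemma pushforward_measure d (T : measurableType d) (R : realType)
    (m : {measure set T -> \bar R}) (g : T -> T) : measurable_fun setT g ->
  exists nu : {measure set T -> \bar R},
    nu = pushforward m g :> (set T -> \bar R).
Proof. by move=> mg; unshelve eexists; [exact: (pushforward m g)|]. Qed.

(** * Frequencies of two-letter words *)

Section Dichotomy.
Variables (R : realType) (X : alphabet) (A : automaton X).
Variables (L : X -> X -> R) (l : X -> R) (mu : probability (seqspace X) R).
Variable s : A.
Hypothesis L_stochastic : stochastic L.
Hypothesis l_prob : probability_vector l.
Hypothesis mu_markov : markov_measure L l mu.
Hypothesis A_connected : strongly_connected A L.

Definition pair_prob (a b : X) : R := l a * L a b.

(** The mass that the stationary input pair puts on the pairs sent to ab by a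
    state drawn from k independently of the input. *)
Definition output_pair_frequency (k : A -> R) (a b : X) : R :=
  \sum_r k r * \sum_x l x * \sum_y L x y *
    ((output r x == a) && (output (trans r x) y == b))%:R.

Lemma tensor_mean (k : A -> R) (h : A * X -> A * X -> R) :
  \sum_p tensor l k p * \sum_q T_matrix L p q * h p q =
  \sum_r k r * \sum_x l x * \sum_y L x y * h (r, x) (trans r x, y).
Proof.
transitivity (\sum_r \sum_x tensor l k (r, x) *
    \sum_q T_matrix L (r, x) q * h (r, x) q).
  by rewrite pair_bigA; apply: eq_bigr => -[].
apply: eq_bigr => r _; rewrite mulr_sumr; apply: eq_bigr => x _.
by rewrite /tensor /= sum_T_matrix mulrA.
Qed.

Lemma input_pair_frequency (k : A -> R) (a b : X) : \sum_r k r = 1 ->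
  \sum_p tensor l k p * \sum_q T_matrix L p q *
    ((p.2 == a) && (q.2 == b))%:R = pair_prob a b.
Proof.
move=> k_sum; rewrite tensor_mean /= -mulr_suml k_sum mul1r.
rewrite (bigD1 a) //= [X in _ + X]big1 ?addr0 => [|x /negPf xa].
  rewrite (bigD1 b) //= !eqxx mulr1 big1 ?addr0 // => y /negPf ->.
  by rewrite mulr0.
by rewrite big1 ?mulr0 // => y _; rewrite xa mulr0.
Qed.

(** Both laws of large numbers are statements about mu; the one for the output
    becomes a statement about the pushforward by reading the count of ab in
    g omega off the prefix of omega. *)
Lemma singular_of_frequency (k : A -> R) (a b : X) :
  \sum_r k r = 1 ->
  stationary_probability_vector (T_matrix L) (tensor l k) ->
  pair_prob a b != output_pair_frequency k a b ->
  singular mu (pushforward mu (action s)).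
Proof.
move=> k_sum t_stat c12.
set c1 := pair_prob a b in c12; set c2 := output_pair_frequency k a b in c12.
(* half the gap: the two acceptance intervals are then disjoint *)
pose e := `|c1 - c2| / 2.
have e_gt0 : 0 < e by rewrite divr_gt0 // normr_gt0 subr_eq0.
pose h x y : R := ((x == a) && (y == b))%:R.
have [K1 K1_ge0 in_law] := weak_law_large_numbers L_stochastic l_prob mu_markov
  A_connected (fun p q => h p.2 q.2) s t_stat e_gt0.
have [K2 K2_ge0 out_law] := weak_law_large_numbers L_stochastic l_prob mu_markov
  A_connected (fun p q => h (emit p) (emit q)) s t_stat e_gt0.
rewrite (input_pair_frequency a b k_sum) -/c1 in in_law.
rewrite tensor_mean -/(output_pair_frequency k a b) -/c2 in out_law.
pose n j := (2 ^ j.+1)%N.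
have n_gt0 j : (0 < n j)%N by rewrite expn_gt0.
pose far c j := prefix_set (X := X) (n j).+1 (deviant h c e (n j)).
have mfar c j : measurable (far c j) by exact: prefix_set_measurable.
have mg := @measurable_action X A s.
have [nu nuE] := pushforward_measure mu mg.
rewrite -nuE.
apply: (singular_criterion (B := fun j => ~` far c1 j)
  (K := K1 + K2)) => [|j|j|j].
- exact: addr_ge0.
- exact: measurableC.
- rewrite setCK.
  have -> : far c1 j = prefix_set (n j).+1 (fun w =>
      deviant (fun p q => h p.2 q.2) c1 e (n j) (annotate s w)).
    congr (prefix_set _ _); apply/funext => w.
    by rewrite -[in LHS](annotateK s w) deviant_map.
  apply: le_trans (in_law (n j) (n_gt0 j)) _.
  by rewrite lee_fin ler_pM2r ?invr_gt0 ?ltr0n // lerDl.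
- apply: (@le_trans _ _ (mu (action s @^-1` far c2 j))).
    rewrite nuE -/(pushforward mu (action s) (far c2 j)) -nuE.
    apply: le_measure; rewrite ?inE //; first exact: measurableC.
    move=> omega /negP; rewrite /far /prefix_set /= -ltNge.
    set S := walk_sum _ _ _ => near1; rewrite leNgt; apply/negP => near2.
    suff : (n j)%:R * `|c1 - c2| < (n j)%:R * (e + e).
      by rewrite /e -splitr ltxx.
    rewrite -[X in X * `|_|]normr_nat -normrM mulrBr mulrDr.
    have -> : (n j)%:R * c1 - (n j)%:R * c2 =
      (S - (n j)%:R * c2) - (S - (n j)%:R * c1) by ring.
    exact: le_lt_trans (ler_normB _ _) (ltrD near2 near1).
  rewrite action_preimage.
  have -> : (fun w => deviant h c2 e (n j) (map emit (annotate s w))) =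
      (fun w =>
         deviant (fun p q => h (emit p) (emit q)) c2 e (n j) (annotate s w)).
    by apply/funext => w; rewrite deviant_map.
  apply: le_trans (out_law (n j) (n_gt0 j)) _.
  by rewrite lee_fin ler_pM2r ?invr_gt0 ?ltr0n // lerDr.
Qed.

(** * States preserving the two-letter masses *)

Section Invariance.
Hypothesis l_gt0 : forall x, 0 < l x.
Hypothesis output_injective : forall r : A, injective (output r).
Hypothesis pair_invariant : forall (r : A) x y,
  pair_prob (output r x) (output (trans r x) y) = pair_prob x y.

(** l is the first marginal of the two-letter masses, and for a fixed first
    letter the second output letter runs over a permutation. *)
Lemma letter_invariant (r : A) x : l (output r x) = l x.
Proof.
have marginal a : \sum_b pair_prob a b = l a.
  by rewrite -mulr_sumr L_stochastic.2 mulr1.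
rewrite -[RHS]marginal -[LHS]marginal.
rewrite (reindex_inj (output_injective (r := trans r x))) /=.
by apply: eq_bigr => y _; exact: pair_invariant.
Qed.

Lemma transition_invariant (r : A) x y :
  L (output r x) (output (trans r x) y) = L x y.
Proof.
apply: (mulfI (lt0r_neq0 (l_gt0 x))).
by rewrite -{1}(letter_invariant r x); exact: pair_invariant.
Qed.

Lemma weight_invariant (r : A) x w :
  walk_weight L (output r x) (map emit (annotate (trans r x) w)) =
  walk_weight L x w.
Proof.
by elim: w r x => //= y w IHw r x; rewrite IHw transition_invariant.
Qed.

Lemma cylinder_invariant w :
  mu (cylinder (map emit (annotate s w))) = mu (cylinder w).
Proof.
case: w => // x w.
by rewrite (mu_markov (output s x)) mu_markov letter_invariant weight_invariant.
Qed.

Lemma same_measure_of_invariant :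
  (forall omega, exists omega', action s omega' = omega) ->
  same_measure mu (pushforward mu (action s)).
Proof.
move=> s_surj.
have [nu nuE] := pushforward_measure mu (@measurable_action X A s).
rewrite -nuE; apply: same_measure_cylinders => [|w].
  exact: le_lt_trans (probability_le1 mu measurableT) (ltry 1).
have [w' _ <-] := emit_surj s_surj w.
by rewrite nuE /pushforward (action_cylinder s_surj); exact: cylinder_invariant.
Qed.

End Invariance.

End Dichotomy.

(** * The dichotomy *)

Theorem lemma7p4 (R : realType) (X : alphabet)
    (L : X -> X -> R) (l : X -> R) (mu : probability (seqspace X) R)
    (A : automaton X) (g : seqspace X -> seqspace X)
    (t : A * X -> R) (k : A -> R)
    (L_stochastic : stochastic L) (L_irreducible : irreducible L)
    (l_stationary : stationary_probability_vector L l)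
    (mu_markov : markov_measure L l mu)
    (g_invertible : bijective g) (g_generated : generated A g)
    (A_connected : strongly_connected A L)
    (t_stationary : stationary_probability_vector (T_matrix L) t)
    (k_stationary : stationary_probability_vector (K_matrix l) k)
    (t_tensor : t = tensor l k) :
  singular mu (pushforward mu g) \/ same_measure mu (pushforward mu g).
Proof.
case: g_generated g_invertible => s -> [g' _ actionK].
have s_surj omega : exists omega', action s omega' = omega.
  by exists (g' omega); exact: actionK.
rewrite {}t_tensor in t_stationary.
have [l_prob _] := l_stationary; have [[k_ge0 k_sum] _] := k_stationary.
have kl_gt0 r x : 0 < k r * l x.
  exact: (stationary_gt0 (T_matrix_stochastic _ L_stochastic)
    (T_matrix_connected A_connected) t_stationary (r, x)).
have l_gt0 x : 0 < l x.
  rewrite lt0r l_prob.1 andbT; apply: contraTneq (kl_gt0 s x) => ->.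
  by rewrite mulr0 ltxx.
have k_gt0 r : 0 < k r.
  rewrite lt0r k_ge0 andbT.
  apply: contraTneq (kl_gt0 r (symbol_point X)) => ->.
  by rewrite mul0r ltxx.
have [freq_eq|freq_neq] := pselect (forall a b,
    pair_prob L l a b = output_pair_frequency L l k a b); last first.
  left; have /existsNP[a /existsNP[b /eqP freq_ab]] := freq_neq.
  exact: (singular_of_frequency _ _ _ mu_markov A_connected k_sum t_stationary
    freq_ab).
right; have output_injective (r : A) : injective (output r).
  have [w [<- _]] := A_connected s r (symbol_point X) (symbol_point X).
  exact: output_inj.
pose sigma (r : A) (p : X * X) := (output r p.1, output (trans r p.1) p.2).
have sigma_inj r : injective (sigma r).
  move=> [x y] [x' y'] [/output_injective -> /output_injective ->] //.
pose m (p : X * X) := pair_prob L l p.1 p.2.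
have m_avg q : \sum_r k r * \sum_p m p * (sigma r p == q)%:R = m q.
  case: q => a b; rewrite /m /= freq_eq; apply: eq_bigr => r _.
  congr (_ * _); transitivity (\sum_x \sum_y m (x, y) *
    (sigma r (x, y) == (a, b))%:R).
    by rewrite pair_bigA; apply: eq_bigr => -[].
  apply: eq_bigr => x _; rewrite mulr_sumr; apply: eq_bigr => y _.
  by rewrite mulrA.
have m_inv := averaged_rearrangement k_gt0 k_sum sigma_inj m_avg.
apply: (same_measure_of_invariant L_stochastic mu_markov l_gt0
  output_injective _ s_surj) => r x y.
exact: (m_inv r (x, y)).
Qed.
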